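(* Let $X,Y$ be Banach spaces, let $F:X\rightrightarrows Y$ be a closed convex set-valued mapping, let $A\subset X$ be a closed convex set, let $\bar y\in Y$, and put $S:=F^{-1}(\bar y)\cap A$. Let $\bar x\in S$. Then $$\frac{1}{{\rm subreg}_AF(\bar x,\bar y)}=\eta_A(F,\bar x,\bar y)=\frac{1}{\tau_A(F,\bar x,\bar y)},$$ where these three quantities are defined below.
   Context: $B_X,B_Y$ denote the closed unit balls of $X,Y$; $B(x,\delta)$ is the open ball of center $x$ and radius $\delta$. $F$ closed convex means its graph ${\rm gph}(F)=\{(x,y):y\in F(x)\}$ is a closed convex subset of $X\times Y$. For a closed convex set $C$ and $a\in C$, the contingent cone $T(C,a)$ is the set of $v$ for which there exist $v_n\to v$ and $t_n\to0^+$ with $a+t_nv_n\in C$ for all $n$. For $(x,y)\in{\rm gph}(F)$ the graphical derivative is $DF(x,y)(u):=\{v\in Y:(u,v)\in T({\rm gph}(F),(x,y))\}$, and $DF^{-1}(y,x)(v):=\{u\in X:(u,v)\in T({\rm gph}(F),(x,y))\}$; for a set $W\subset Y$, $DF^{-1}(y,x)(W)=\bigcup_{v\in W}DF^{-1}(y,x)(v)$. Distances to the empty set are $+\infty$; $1/0=+\infty$, $1/(+\infty)=0$. Definitions: ${\rm subreg}_AF(\bar x,\bar y):=\inf\{\tau>0:\exists\delta>0$ such that $d(x,S)\le\tau(d(\bar y,F(x))+d(x,A))$ for all $x\in B(\bar x,\delta)\}$ (infimum of the empty set is $+\infty$). For $x\in S$ and $\eta>0$, condition (P) is: $DF^{-1}(\bar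 y,x)(\eta_1B_Y)\cap(T(A,x)+\eta_2B_X)\subset T(S,x)+B_X$ for all $\eta_1,\eta_2\ge0$ with $\eta_1+\eta_2<\eta$. For $x\in S$ and $\tau>0$, condition (Q) is: $d(h,T(S,x))\le\tau\big(d(0,DF(x,\bar y)(h))+d(h,T(A,x))\big)$ for all $h\in X$. $\eta_A(F,\bar x,\bar y):=\sup\{\eta>0:\exists\delta>0$ such that (P) holds for every $x\in S\cap B(\bar x,\delta)\}$ (supremum of the empty set is $0$). $\tau_A(F,\bar x,\bar y):=\inf\{\tau>0:\exists\delta>0$ such that (Q) holds for every $x\in S\cap B(\bar x,\delta)\}$ (infimum of the empty set is $+\infty$). *)

(* Defs.v *)
From HB Require Import structures.
From mathcomp Require Import all_boot all_order all_algebra.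
From mathcomp Require Import all_classical all_reals all_analysis.
Set Implicit Arguments. Unset Strict Implicit. Unset Printing Implicit Defensive.
Import Order.TTheory GRing.Theory Num.Theory.
Import numFieldNormedType.Exports.
Local Open Scope classical_set_scope.
Local Open Scope ring_scope.

(* distance from a point to a set, in the extended reals; d(x, empty) = +oo *)
Definition dist {R : realType} {V : normedModType R} (x : V) (C : set V) : \bar R :=
  ereal_inf [set (`|x - c|)%:E | c in C].

Definition contingent_cone {R : realType} {V : normedModType R} (C : set V) (a : V)
  : set V :=
  [set v | exists (vn : nat -> V) (tn : nat -> R),
      vn @ \oo --> v /\ tn @ \oo --> (0 : R) /\ (forall n, 0 < tn n) /\
      (forall n, C (a + tn n *: vn n))].

Definition gph {X Y : Type} (F : X -> set Y) : set (X * Y) :=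
  [set p | F p.1 p.2].

Definition closed_convex_map {R : realType} {X Y : normedModType R}
  (F : X -> set Y) : Prop :=
  closed (gph F) /\ convex_set (gph F : set (convex_lmodType (X * Y)%type)).

Definition solset {X Y : Type} (F : X -> set Y) (A : set X) (ybar : Y) : set X :=
  [set x | F x ybar /\ A x].

Definition gder {R : realType} {X Y : normedModType R} (F : X -> set Y)
  (x : X) (y : Y) (u : X) : set Y :=
  [set v | contingent_cone (gph F) (x, y) (u, v)].

Definition gder_inv_img {R : realType} {X Y : normedModType R} (F : X -> set Y)
  (y : Y) (x : X) (W : set Y) : set X :=
  [set u | exists2 v, W v & contingent_cone (gph F) (x, y) (u, v)].

Definition cball0 {R : realType} {V : normedModType R} (r : R) : set V :=
  [set b | `|b| <= r].

Definition plus_ball {R : realType} {V : normedModType R} (C : set V) (r : R) : set V :=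
  [set c + b | c in C & b in cball0 r].

(* 1/t on [0,+oo] with 1/0 = +oo and 1/(+oo) = 0 *)
Definition einv {R : realType} (t : \bar R) : \bar R :=
  match t with
  | EFin r => if r == 0 then +oo%E else (r^-1)%:E
  | +oo%E => 0%E
  | -oo%E => 0%E
  end.

Definition subreg {R : realType} {X Y : normedModType R}
  (A : set X) (F : X -> set Y) (xbar : X) (ybar : Y) : \bar R :=
  ereal_inf [set tau%:E | tau in [set tau : R | 0 < tau /\
    exists2 delta : R, 0 < delta & forall x : X, `|x - xbar| < delta ->
      (dist x (solset F A ybar) <= tau%:E * (dist ybar (F x) + dist x A))%E]].

Definition condP {R : realType} {X Y : normedModType R}
  (A : set X) (F : X -> set Y) (ybar : Y) (x : X) (eta : R) : Prop :=
  forall eta1 eta2 : R, 0 <= eta1 -> 0 <= eta2 -> eta1 + eta2 < eta ->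
    gder_inv_img F ybar x (cball0 eta1) `&` plus_ball (contingent_cone A x) eta2
    `<=` plus_ball (contingent_cone (solset F A ybar) x) 1.

Definition condQ {R : realType} {X Y : normedModType R}
  (A : set X) (F : X -> set Y) (ybar : Y) (x : X) (tau : R) : Prop :=
  forall h : X,
    (dist h (contingent_cone (solset F A ybar) x) <=
     tau%:E * (dist (0%R : Y) (gder F x ybar h) + dist h (contingent_cone A x)))%E.

(* sup over eta > 0; the extra 0 makes the sup of the empty family equal 0
   (all other elements are > 0, so it does not change a nonempty sup) *)
Definition eta_A {R : realType} {X Y : normedModType R}
  (A : set X) (F : X -> set Y) (xbar : X) (ybar : Y) : \bar R :=
  ereal_sup ([set 0%E] `|` [set eta%:E | eta in [set eta : R | 0 < eta /\
    exists2 delta : R, 0 < delta & forall x : X,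
      solset F A ybar x -> `|x - xbar| < delta -> condP A F ybar x eta]]).

Definition tau_A {R : realType} {X Y : normedModType R}
  (A : set X) (F : X -> set Y) (xbar : X) (ybar : Y) : \bar R :=
  ereal_inf [set tau%:E | tau in [set tau : R | 0 < tau /\
    exists2 delta : R, 0 < delta & forall x : X,
      solset F A ybar x -> `|x - xbar| < delta -> condQ A F ybar x tau]].

(* Main.v *)
Require Import Defs.
From HB Require Import structures.
From mathcomp Require Import all_boot all_order all_algebra.
From mathcomp Require Import all_classical all_reals all_analysis.
From mathcomp Require Import ring lra.
Import Order.TTheory GRing.Theory Num.Theory.
Import numFieldNormedType.Exports.
Local Open Scope classical_set_scope.
Local Open Scope ring_scope.

(* By positive homogeneity of contingent cones, (P) for [eta] is equivalent to (Q)
   for [1/eta]. Metric subregularity with constant [tau] implies (Q) with the same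
   [tau]: apply it at points [x + t h] and divide by [t]; by convexity the nearby
   points of [S] give elements of [T(S,x)]. Conversely, given [x] near [xbar],
   Ekeland's principle applied to [u |-> |x - u|] on [S], started at [xbar], yields
   [s] in [S] near [xbar] with [(1-e)|x-s| <= (1+e) d(x-s, T(S,s))]. Condition (Q)
   at [s] for [h = x - s] bounds the right-hand side, because [gph F - (s,ybar)]
   and [A - s] lie in the corresponding contingent cones. *)

(** * Distances to sets in the extended reals *)

Section Distance.
Context {R : realType}.

Lemma dist_le {V : normedModType R} (x c : V) (C : set V) :
  C c -> (dist x C <= `|x - c|%:E)%E.
Proof. by move=> Cc; apply: ereal_inf_lbound; exists c. Qed.

Lemma le_dist {V : normedModType R} (r : R) (x : V) (C : set V) :
  (forall c, C c -> r <= `|x - c|) -> (r%:E <= dist x C)%E.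
Proof.
by move=> rC; apply: le_ereal_inf_tmp => _ [c Cc <-]; rewrite lee_fin rC.
Qed.

Lemma dist_lt_ex {V : normedModType R} (x : V) (C : set V) (r : R) :
  (dist x C < r%:E)%E -> exists2 c, C c & `|x - c| < r.
Proof. by move=> /ereal_inf_lt[_ [c Cc <-]]; rewrite lte_fin; exists c. Qed.

Lemma dist_ge0 {V : normedModType R} (x : V) (C : set V) : (0 <= dist x C)%E.
Proof. by apply: le_dist. Qed.

(** Allows a sum of two distances to be replaced by norms at chosen points. An empty set makes the
    right-hand side infinite, as [tau] is positive; otherwise near-minimizers are taken, each with
    slack [e / (2 * tau)]. *)
Lemma le_dist_add {V W : normedModType R} (d : \bar R) (tau : R)
    (x : V) (C : set V) (y : W) (D : set W) :
  0 < tau ->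
  (forall c e, C c -> D e -> (d <= (tau * (`|x - c| + `|y - e|))%:E)%E) ->
  (d <= tau%:E * (dist x C + dist y D))%E.
Proof.
move=> tau0 H.
have := dist_ge0 x C; have := dist_ge0 y D.
case EC : (dist x C) => [r| |] //; case ED : (dist y D) => [s| |] // _ _;
  rewrite ?addye ?addey ?gt0_muley ?lte_fin ?leey //.
rewrite -EFinD -EFinM; apply/lee_addgt0Pr => e e0.
have t0 : 0 < e / (2 * tau) by rewrite divr_gt0 // mulr_gt0.
have [c Cc xc] : exists2 c, C c & `|x - c| < r + e / (2 * tau).
  by apply: dist_lt_ex; rewrite EC lte_fin ltrDl.
have [u Du yu] : exists2 c, D c & `|y - c| < s + e / (2 * tau).
  by apply: dist_lt_ex; rewrite ED lte_fin ltrDl.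
apply: (le_trans (H _ _ Cc Du)); rewrite -EFinD lee_fin.
apply: (@le_trans _ _ (tau * ((r + e / (2 * tau)) + (s + e / (2 * tau))))).
  by rewrite ler_pM2l // lerD // ltW.
by rewrite le_eqVlt; apply/orP; left; apply/eqP; field; rewrite gt_eqF.
Qed.

End Distance.

(** * Contingent cones, with feasible steps shortened by convexity *)

Section ContingentCone.
Context {R : realType} {V : normedModType R}.
Implicit Types (C : set V) (a v : V).

Lemma convex_set_segment C a b (t : R) :
  convex_set (C : set (convex_lmodType V)) -> C a -> C b ->
  0 <= t -> t <= 1 -> C (a + t *: (b - a)).
Proof.
move=> cC Ca Cb t0 t1.
have := cC b a (Itv01 t0 t1) (mem_set Cb) (mem_set Ca).
move=> /set_mem; rewrite [X in C X](_ : _ = a + t *: (b - a)) //.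
rewrite /conv/= /unstable.onem scalerBl scale1r scalerBr.
by rewrite addrCA.
Qed.

Lemma convex_set_ray C a v (t s : R) :
  convex_set (C : set (convex_lmodType V)) -> C a -> C (a + t *: v) ->
  0 < t -> 0 <= s -> s <= t -> C (a + s *: v).
Proof.
move=> cC Ca Cv t0 s0 st.
have := @convex_set_segment C a _ (s / t) cC Ca Cv.
rewrite addrAC subrr add0r scalerA divfK ?gt_eqF //; apply.
  by rewrite divr_ge0 // ltW.
by rewrite ler_pdivrMr // mul1r.
Qed.

(** By convexity one feasible step [t] makes all shorter ones feasible, so the constant sequence [v]
    with steps [t / (n + 1)] is a witness. *)
Lemma contingent_cone_ray C a v (t : R) :
  convex_set (C : set (convex_lmodType V)) -> C a -> 0 < t ->
  C (a + t *: v) -> contingent_cone C a v.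
Proof.
move=> cC Ca t0 Cv; exists (fun=> v), (fun n => t * n.+1%:R^-1).
split; first exact: cvg_cst.
split.
  rewrite -[X in _ --> X](mulr0 t); apply: cvgMl_tmp; exact: cvg_harmonic.
split=> n; first by rewrite mulr_gt0 // invr_gt0.
apply: (@convex_set_ray C a v t) => //.
  by rewrite mulr_ge0 ?invr_ge0 // ltW.
by rewrite ler_piMr ?(ltW t0) // invf_le1 ?ltr0n // ler1n.
Qed.

Lemma contingent_cone_sub C a b :
  convex_set (C : set (convex_lmodType V)) -> C a -> C b ->
  contingent_cone C a (b - a).
Proof.
move=> cC Ca Cb; apply: (@contingent_cone_ray _ _ _ 1) => //.
by rewrite scale1r addrC subrK.
Qed.

Lemma contingent_cone0 C a : C a -> contingent_cone C a 0.
Proof.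
move=> Ca; exists (fun=> 0), (fun n => n.+1%:R^-1).
split; first exact: cvg_cst.
split; first exact: cvg_harmonic.
by split=> n; rewrite ?invr_gt0 // scaler0 addr0.
Qed.

Lemma contingent_coneZ C a v (l : R) : 0 < l ->
  contingent_cone C a v -> contingent_cone C a (l *: v).
Proof.
move=> l0 [vn [tn [vnv [tn0 [tnp Cn]]]]].
exists (fun n => l *: vn n), (fun n => tn n / l).
split; first exact: cvgZl_tmp.
split; first by rewrite -[X in _ --> X](mul0r l^-1); exact: cvgMr_tmp.
split=> n; first by rewrite divr_gt0.
by rewrite scalerA divfK ?gt_eqF.
Qed.

Lemma contingent_cone_approx C a v (e : R) : 0 < e -> contingent_cone C a v ->
  exists w t, [/\ `|v - w| < e, 0 < t, t < e & C (a + t *: w)].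
Proof.
move=> e0 [vn [tn [vnv [tn0 [tnp Cn]]]]].
have [M _ tM] := (cvgrPdist_lt _ _).1 tn0 e e0.
have [K _ vK] := (cvgrPdist_lt _ _).1 vnv e e0.
pose n := maxn K M.
exists (vn n), (tn n); split=> //; first by apply: vK; rewrite /= leq_maxl.
have := tM n; rewrite /= leq_maxr => /(_ isT).
by rewrite sub0r normrN gtr0_norm.
Qed.

End ContingentCone.

(** * Ekeland's principle and almost projections *)

(** The sets [L s] are the lower sets of a partial order on [S]. Choosing almost minimizers of [f]
    successively gives nested closed sets [L (u_ n)] with diameters tending to 0; completeness
    provides their common point. *)
Lemma ekeland_variational {R : realType} {X : completeNormedModType R}
    (S : set X) (f : X -> R) (e : R) (s0 : X) :
  closed S -> continuous f -> (forall x, 0 <= f x) -> 0 < e -> S s0 ->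
  exists s, [/\ S s, f s <= f s0 & forall u, S u -> f s <= f u + e * `|u - s|].
Proof.
move=> clS cf f0 e0 Ss0.
pose L s : set X := [set u | S u /\ f u + e * `|u - s| <= f s].
have Lrefl s : S s -> L s s.
  by move=> Ss; split=> //; rewrite subrr normr0 mulr0 addr0.
have Ltrans s u w : L s u -> L u w -> L s w.
  move=> [Su su] [Sw uw]; split=> //.
  have : `|w - s| <= `|w - u| + `|u - s| by rewrite -[w - s](subrKA u) ler_normD.
  by rewrite -(ler_pM2l e0); lra.
have clL s : closed (L s).
  apply: closedI => //.
  apply: (@preimage_closed _ _ (fun u => f u + e * `|u - s|) [set x | x <= f s]).
    move=> x _; apply: cvgD; first exact: cf.
    apply: cvgMl_tmp; apply: (@cvg_norm _ _ _ _ _ (fun u => u - s)).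
    by apply: cvgB; [exact: cvg_id|exact: cvg_cst].
  exact: closed_le.
(* The premise [S p.2] sits under the existential so that choice gives a total function; [p.1] sets
   the tolerance. *)
have step (p : nat * X) : exists s', S p.2 ->
    L p.2 s' /\ forall u, L p.2 u -> f s' <= f u + p.1.+1%:R^-1.
  case: p => n s /=; have [Ss|nSs] := pselect (S s); last by exists s.
  have hi : has_inf (f @` L s).
    by split; [exists (f s), s => //; exact: Lrefl|exists 0 => _ [u _ <-]].
  have n0 : (0 : R) < n.+1%:R^-1 by rewrite invr_gt0.
  have [_ [s' Ls' <-] fs'] := inf_adherent n0 hi.
  exists s' => _; split=> // u Lu; apply/ltW/(lt_le_trans fs').
  by rewrite lerD2r; apply: ge_inf; [case: hi|exists u].
have [g gP] := choice step.
pose u_ := fix u_ n : X := if n is m.+1 then g (m, u_ m) else s0.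
have Su n : S (u_ n).
  by elim: n => // n IH; have [[]] := gP (n, u_ n) IH.
have LS n : L (u_ n) (u_ n.+1) by have [] := gP (n, u_ n) (Su n).
have Lle n m : (n <= m)%N -> L (u_ n) (u_ m).
  move=> /subnK <-; elim: (m - n)%N => [|k IH]; first exact: Lrefl.
  exact: Ltrans IH (LS _).
have diam n w : L (u_ n.+1) w -> e * `|w - u_ n.+1| <= n.+1%:R^-1.
  move=> Lw; have h : f (u_ n.+1) <= f w + n.+1%:R^-1.
    exact: (gP (n, u_ n) (Su n)).2 _ (Ltrans _ _ _ (LS n) Lw).
  by have [_ h'] := Lw; rewrite -(lerD2l (f w)); exact: le_trans h' h.
have small (r : R) : 0 < r -> exists n, n.+1%:R^-1 < r.
  move=> r0; have [N _ /(_ N (leqnn _))] := (cvgrPdist_lt _ _).1 cvg_harmonic r r0.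
  by rewrite sub0r normrN ger0_norm ?invr_ge0 // => ?; exists N.
have cu : cvg (u_ @ \oo).
  apply: cauchy_cvg; apply: cauchy_exP => r r0.
  have [N HN] := small (e * r) (mulr_gt0 e0 r0).
  exists (u_ N.+1); exists N.+1 => // m /= Nm.
  have := diam N _ (Lle _ _ Nm).
  move=> /le_lt_trans/(_ HN); rewrite ltr_pM2l // distrC.
  by rewrite -ball_normE.
pose s := lim (u_ @ \oo).
have Ls n : L (u_ n) s.
  apply: (@closed_cvg _ _ \oo _ u_ (L (u_ n))) => //.
  by exists n => // m /= nm; exact: Lle.
exists s; split.
- by have [] := Ls 0%N.
- have [_] := Ls 0%N; apply: le_trans; rewrite lerDl mulr_ge0 //; exact: ltW.
(* A violating [w] would lie in every [L (u_ n)], as [s] does, so the vanishing diameters would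
   force [w = s]. *)
move=> w Sw; rewrite leNgt; apply/negP => lt_ws.
have Lw n : L (u_ n) w by apply: Ltrans (Ls n) _; split=> //; exact: ltW.
have [ws|ws] := eqVneq w s.
  by move: lt_ws; rewrite ws subrr normr0 mulr0 addr0 ltxx.
have ws0 : 0 < e * `|w - s| / 2 by rewrite divr_gt0 // mulr_gt0 // normr_gt0 subr_eq0.
have [n hn] := small _ ws0.
have := diam n _ (Lw _); have := diam n _ (Ls _).
have : `|w - s| <= `|w - u_ n.+1| + `|s - u_ n.+1|.
  by rewrite (distrC s) -[w - s](subrKA (u_ n.+1)) ler_normD.
rewrite -(ler_pM2l e0); move: (n.+1%:R^-1) hn => r; lra.
Qed.

(* Convexity of the norm along the segment from [x - s] to [x - s - c] turns the
   first-order optimality of [s] into a bound on all of [x - s - T(S, s)]. *)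
Lemma contingent_cone_almost_projection {R : realType} {V : normedModType R}
    (S : set V) (x s c : V) (e : R) :
  convex_set (S : set (convex_lmodType V)) -> 0 < e -> S s ->
  (forall u, S u -> `|x - s| <= `|x - u| + e * `|u - s|) ->
  contingent_cone S s c -> (1 - e) * `|x - s| <= (1 + e) * `|x - s - c|.
Proof.
move=> cS e0 Ss opt Tc.
have ray w t : 0 < t -> S (s + t *: w) ->
    (1 - e) * `|x - s| <= (1 + e) * `|x - s - w|.
  move=> t0 Sw.
  (* The cap at 1 makes [x - (s + r *: w)] a convex combination of [x - s] and [x - s - w]. *)
  pose r := Num.min t 1.
  have r0 : 0 < r by rewrite lt_min t0 ltr01.
  have r1 : r <= 1 by rewrite ge_min lexx orbT.
  have Sr : S (s + r *: w).
    by apply: (@convex_set_ray _ _ S s w t) => //; rewrite ?(ltW r0) // ge_min lexx.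
  have := opt _ Sr; rewrite [s + _ - s]addrAC subrr add0r normrZ gtr0_norm //.
  have : `|x - (s + r *: w)| <= (1 - r) * `|x - s| + r * `|x - s - w|.
    have -> : x - (s + r *: w) = (1 - r) *: (x - s) + r *: (x - s - w).
      by rewrite [r *: (_ - w)]scalerBr addrA -scalerDl subrK scale1r opprD addrA.
    apply: (le_trans (ler_normD _ _)).
    by rewrite !normrZ (gtr0_norm r0) ger0_norm ?subr_ge0.
  have : `|w| <= `|x - s| + `|x - s - w|.
    by rewrite -{1}[w](subKr (x - s)); exact: ler_normB.
  move=> nw h1 h2.
  have h3 : r * `|x - s| <= r * (`|x - s - w| + e * `|w|) by lra.
  rewrite ler_pM2l // in h3.
  by move: nw; rewrite -(ler_pM2l e0); lra.
(* The bound holds for feasible directions [w]; a general [c] in the cone is a limit of such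
   directions. *)
apply/ler_addgt0Pr => d d0.
have d'0 : 0 < d / (1 + e) by rewrite divr_gt0 // addr_gt0.
have [w [t [cw t0 _ Sw]]] := contingent_cone_approx _ _ _ _ d'0 Tc.
apply: (le_trans (ray w t t0 Sw)).
have e1 : 0 < 1 + e by rewrite addr_gt0.
have -> : (1 + e) * `|x - s - c| + d = (1 + e) * (`|x - s - c| + d / (1 + e)).
  by rewrite mulrDr [(1 + e) * (d / _)]mulrC divfK // gt_eqF.
rewrite ler_pM2l //.
rewrite -[x - s - w](subrKA c); apply: (le_trans (ler_normD _ _)).
by rewrite lerD2l ltW.
Qed.

(** * Relations between (P), (Q) and metric subregularity *)

Section Conditions.
Context {R : realType} {X Y : normedModType R}.
Context (F : X -> set Y) (A : set X) (ybar : Y).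
Local Notation S := (solset F A ybar).

(** The strict inequality [e1 + e2 < tau^-1] makes the distance in (Q) less than 1, so some point of
    the cone is within 1 even if the infimum is not attained. *)
Lemma condQ_condP (x : X) (tau : R) :
  0 < tau -> condQ A F ybar x tau -> condP A F ybar x tau^-1.
Proof.
move=> tau0 Q e1 e2 e10 e20 e12 h [[v ve1 hv] [a Ta [b be2 abh]]].
have [c Tc hc] : exists2 c, contingent_cone S x c & `|h - c| < 1.
  apply: dist_lt_ex; apply: (le_lt_trans (Q h)).
  apply: (@le_lt_trans _ _ (tau%:E * (e1 + e2)%:E)%E).
    apply: lee_wpmul2l; first by rewrite lee_fin ltW.
    rewrite EFinD; apply: leeD.
      apply: (le_trans (@dist_le _ _ _ v _ hv)).
      by rewrite sub0r normrN lee_fin.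
    apply: (le_trans (@dist_le _ _ _ a _ Ta)).
    by rewrite -abh addrAC subrr add0r lee_fin.
  by rewrite -EFinM lte_fin mulrC -ltr_pdivlMr // div1r.
exists c => //; exists (h - c); first exact: ltW.
by rewrite addrC subrK.
Qed.

(* Both sides of (Q) are positively homogeneous in [h], so (P) is applied to
   [l *: h] with [l] as large as its constraint allows. *)
Lemma condP_condQ (x : X) (eta : R) :
  0 < eta -> condP A F ybar x eta -> condQ A F ybar x eta^-1.
Proof.
move=> eta0 P h; apply: le_dist_add => [|v a Dv Ta]; first by rewrite invr_gt0.
set r := `|0 - v| + `|h - a|.
apply/lee_addgt0Pr => e e0.
have r0 : 0 <= r by rewrite addr_ge0.
(* The term [e] makes the constraint of (P) strict after division by [m], and keeps [m] positive
   when [r = 0]. *)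
pose m := eta^-1 * r + e.
have m0 : 0 < m by rewrite ltr_wpDl // mulr_ge0 // invr_ge0 ltW.
have [||||c Tc [b b1 cb]] :=
  P (m^-1 * `|v|) (m^-1 * `|h - a|) _ _ _ (m^-1 *: h).
- by rewrite mulr_ge0 ?invr_ge0 ?(ltW m0).
- by rewrite mulr_ge0 ?invr_ge0 ?(ltW m0).
- rewrite -mulrDr -[`|v|]normrN -sub0r -/r mulrC ltr_pdivrMr // /m mulrDr.
  by rewrite mulrA divff ?gt_eqF // mul1r ltrDl mulr_gt0.
- split.
    exists (m^-1 *: v); first by rewrite /cball0/= normrZ gtr0_norm // invr_gt0.
    by apply: (@contingent_coneZ _ _ _ _ (h, v)) => //; rewrite invr_gt0.
  exists (m^-1 *: a); first by apply: contingent_coneZ => //; rewrite invr_gt0.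
  exists (m^-1 *: (h - a)); first by rewrite /cball0/= normrZ gtr0_norm // invr_gt0.
  by rewrite -scalerDr addrC subrK.
have Tmc := contingent_coneZ _ _ _ _ m0 Tc.
apply: (le_trans (dist_le _ _ _ Tmc)).
have -> : h - m *: c = m *: b.
  rewrite -[h]scale1r -(divff (lt0r_neq0 m0)) -scalerA -cb.
  by rewrite -scalerBr addrAC subrr add0r.
rewrite normrZ gtr0_norm // -EFinD lee_fin -/m -[leRHS]mulr1.
by rewrite ler_pM2l.
Qed.

Context (cF : closed_convex_map F)
  (cA : convex_set (A : set (convex_lmodType X))).

Lemma convex_solset : convex_set (S : set (convex_lmodType X)).
Proof.
move=> x y t; rewrite !inE => -[Fx Ax] [Fy Ay]; split; last first.
  by apply/set_mem/cA; rewrite inE.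
have := cF.2 (x, ybar) (y, ybar) t (mem_set Fx) (mem_set Fy).
move=> /set_mem; rewrite /gph/= /conv/= -[X in F _ X]scalerDl.
by rewrite /unstable.onem [X in X *: ybar]addrC subrK scale1r.
Qed.

Lemma closed_solset : closed A -> closed S.
Proof.
move=> clA; apply: closedI => //.
apply: (@preimage_closed _ _ (fun x => (x, ybar)) (gph F)); last exact: cF.1.
by move=> x _; apply: cvg_pair; [exact: cvg_id|exact: cvg_cst].
Qed.

Lemma subreg_bound_condQ (x : X) (tau : R) : 0 < tau -> S x ->
  (\forall z \near x, (dist z S <= tau%:E * (dist ybar (F z) + dist z A))%E) ->
  condQ A F ybar x tau.
Proof.
move=> tau0 Sx /nbhs_ballP [delta /= delta0 Hd] h.
apply: le_dist_add => // v a Dv Ta; rewrite sub0r normrN.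
apply/lee_addgt0Pr => e e0.
(* Error budget in units of [d]: one from [v'] and two from [h' - a'], each multiplied by [tau],
   then one from [h - h'] and one from choosing [s']. *)
pose k := 3 * tau + 2.
have k0 : 0 < k by rewrite /k; lra.
pose d := e / k.
have d0 : 0 < d by rewrite divr_gt0.
have [a' [s [aa' s0 _ As]]] := contingent_cone_approx _ _ _ _ d0 Ta.
pose nh := `|h| + d + 1.
have nh0 : 0 < nh by rewrite /nh ltr_wpDl // addr_ge0 // ltW.
(* The step [t] for the graph is taken after [s] and below it, so convexity of [A] lets the same [t]
   serve [a']; the bound [delta / nh] keeps [z] in the ball where the hypothesis applies. *)
pose q := Num.min d (Num.min s (delta / nh)).
have q0 : 0 < q by rewrite !lt_min d0 s0 divr_gt0.
have [[h' v'] [t [hvd t0 tq Ft]]] := contingent_cone_approx _ _ _ _ q0 Dv.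
have [hh' vv'] : `|h - h'| < d /\ `|v - v'| < d.
  move: hvd; rewrite prod_normE/= gt_max !lt_min => /andP[].
  by move=> /and3P[-> _ _] /and3P[->].
have [ts tdelta] : t <= s /\ t < delta / nh.
  by move: tq; rewrite !lt_min => /and3P[_ /ltW].
pose z := x + t *: h'.
have zS : (dist z S <= (tau * (t * `|v'| + t * `|h' - a'|))%:E)%E.
  apply: (le_trans (Hd z _)).
    rewrite -ball_normE /= opprD addrA subrr sub0r normrN normrZ gtr0_norm //.
    rewrite (@le_lt_trans _ _ (t * nh)) // -?ltr_pdivlMr // ler_pM2l // /nh.
    have : `|h'| <= `|h| + `|h - h'|.
      by rewrite -{1}[h'](subKr h); exact: ler_normB.
    lra.
  rewrite EFinM; apply: lee_wpmul2l; first by rewrite lee_fin ltW.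
  rewrite EFinD; apply: leeD.
    apply: (le_trans (@dist_le _ _ _ (ybar + t *: v') _ Ft)).
    by rewrite opprD addrA subrr sub0r normrN normrZ gtr0_norm.
  have At : A (x + t *: a').
    by apply: (@convex_set_ray _ _ A x a' s) => //; [exact: Sx.2|exact: ltW].
  apply: (le_trans (dist_le _ _ _ At)).
  by rewrite opprD addrACA subrr add0r -scalerBr normrZ gtr0_norm.
have [s' Ss' zs'] : exists2 s', S s' &
    `|z - s'| < tau * (t * `|v'| + t * `|h' - a'|) + t * d.
  by apply: dist_lt_ex; rewrite (le_lt_trans zS) // lte_fin ltrDl mulr_gt0.
pose c := t^-1 *: (s' - x).
have Tc : contingent_cone S x c.
  apply: (@contingent_cone_ray _ _ _ _ _ t) => //; first exact: convex_solset.
  by rewrite scalerA divff ?gt_eqF // scale1r addrC subrK.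
apply: (le_trans (dist_le _ _ _ Tc)); rewrite -EFinD lee_fin.
have : `|h' - c| <= tau * (`|v'| + `|h' - a'|) + d.
  rewrite -(ler_pM2l t0) -{1}(gtr0_norm t0) -normrZ scalerBr scalerA.
  rewrite divff ?gt_eqF // scale1r opprB addrCA addrA.
  by apply: (le_trans (ltW zs')); lra.
have : `|h - c| <= `|h - h'| + `|h' - c|.
  by rewrite -[h - c](subrKA h') ler_normD.
have : `|v'| <= `|v| + `|v - v'|.
  by rewrite -{1}[v'](subKr v); exact: ler_normB.
have : `|h' - a'| <= `|h - h'| + (`|h - a| + `|a - a'|).
  rewrite (distrC h) -[h' - a'](subrKA h) (le_trans (ler_normD _ _)) // lerD2l.
  by rewrite -[h - a'](subrKA a) ler_normD.
move=> ha nv.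
have : tau * (`|v'| + `|h' - a'|) <= tau * (`|v| + `|h - a| + 3 * d).
  by rewrite ler_pM2l //; lra.
have : e = k * d by rewrite /d mulrC divfK // gt_eqF.
rewrite /k; lra.
Qed.

End Conditions.

(* Ekeland's principle replaces the metric projection of [x] onto [S], which need
   not exist; the price is passing from [tau] to a slightly larger [tau']. *)
Lemma condQ_subreg_bound {R : realType} {X : completeNormedModType R}
    {Y : normedModType R} (F : X -> set Y) (A : set X) (ybar : Y) (xbar : X)
    (tau tau' delta : R) :
  closed_convex_map F -> closed A ->
  convex_set (A : set (convex_lmodType X)) -> solset F A ybar xbar ->
  0 < tau -> tau < tau' ->
  (forall s, solset F A ybar s -> `|s - xbar| < delta -> condQ A F ybar s tau) ->
  forall x, `|x - xbar| < delta / 2 ->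
    (dist x (solset F A ybar) <= tau'%:E * (dist ybar (F x) + dist x A))%E.
Proof.
move=> cF clA cA Sxbar tau0 ltt Q x xd.
have tau'0 : 0 < tau' by exact: lt_trans ltt.
have cS := convex_solset F A ybar cF cA.
(* Chosen so that [(1 - e) / (1 + e) = tau / tau']. *)
pose e := (tau' - tau) / (tau' + tau).
have e0 : 0 < e by rewrite divr_gt0 ?subr_gt0 ?addr_gt0.
have [s [Ss ssbar opt]] : exists s, [/\ solset F A ybar s,
    `|x - s| <= `|x - xbar| &
    forall u, solset F A ybar u -> `|x - s| <= `|x - u| + e * `|u - s|].
  apply: (@ekeland_variational _ _ (solset F A ybar) (fun s => `|x - s|)) => //.
    exact: closed_solset.
  move=> u; apply: (@cvg_norm _ _ _ _ _ (fun u => x - u)).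
  by apply: cvgB; [exact: cvg_cst|exact: cvg_id].
(* Since [s] is no farther from [x] than [xbar] is, [s] lies within twice the distance from [x] to
   [xbar], whence the radius [delta / 2]. *)
have sd : `|s - xbar| < delta.
  have : `|s - xbar| <= `|s - x| + `|x - xbar|.
    by rewrite -[s - xbar](subrKA x) ler_normD.
  by rewrite (distrC s x); lra.
apply: le_dist_add => // y a Fy Aa.
apply: (le_trans (dist_le _ _ _ Ss)); rewrite lee_fin.
have Ty : gder F s ybar (x - s) (y - ybar).
  by apply: (@contingent_cone_sub _ _ (gph F) (s, ybar) (x, y)) => //;
    [exact: cF.2|exact: Ss.1].
have Ta : contingent_cone A s (a - s).
  by apply: contingent_cone_sub => //; exact: Ss.2.
have ub : (dist (x - s)%R (contingent_cone (solset F A ybar) s) <=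
    (tau * (`|ybar - y| + `|x - a|))%:E)%E.
  apply: (le_trans (Q s Ss sd (x - s))).
  rewrite EFinM; apply: lee_wpmul2l; first by rewrite lee_fin ltW.
  rewrite EFinD; apply: leeD.
    by apply: (le_trans (dist_le _ _ _ Ty)); rewrite sub0r opprB.
  apply: (le_trans (dist_le _ _ _ Ta)).
  by rewrite opprB addrA subrK.
have lb : (((tau / tau') * `|x - s|)%:E <=
    dist (x - s)%R (contingent_cone (solset F A ybar) s))%E.
  apply: le_dist => c Tc.
  have := contingent_cone_almost_projection _ _ _ _ _ cS e0 Ss opt Tc.
  have tt0 : tau' + tau != 0 by rewrite gt_eqF ?addr_gt0.
  have -> : 1 - e = 2 * tau' / (tau' + tau) * (tau / tau').
    by rewrite /e; field; rewrite tt0 gt_eqF.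
  have -> : 1 + e = 2 * tau' / (tau' + tau) by rewrite /e; field.
  by rewrite -[_ * (tau / tau') * _]mulrA ler_pM2l //
     divr_gt0 ?addr_gt0 ?mulr_gt0.
have := le_trans lb ub; rewrite lee_fin.
by rewrite -mulrA ler_pM2l // mulrC ler_pdivrMr // mulrC.
Qed.

(** * Reciprocals of infima and equality of the three quantities *)

(** Inversion reverses order on positive reals. The added 0 matches [1/(+oo) = 0] when [G] is
    empty. *)
Lemma ereal_sup_inv_einv_inf {R : realType} (G : set R) :
  (forall t, G t -> 0 < t) ->
  ereal_sup ([set 0%E] `|` [set t^-1%:E | t in G]) =
  einv (ereal_inf [set t%:E | t in G]).
Proof.
move=> G0; have inf0 : (0 <= ereal_inf [set t%:E | t in G])%E.
  by apply: le_ereal_inf_tmp => _ [t Gt <-]; rewrite lee_fin ltW // G0.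
have infG t : G t -> (ereal_inf [set t%:E | t in G] <= t%:E)%E.
  by move=> Gt; apply: ereal_inf_lbound; exists t.
have ltG r : (ereal_inf [set t%:E | t in G] < r%:E)%E -> exists2 t, G t & t < r.
  by move=> /ereal_inf_lt[_ [t Gt <-]]; rewrite lte_fin; exists t.
have supG t : G t -> (t^-1%:E <= ereal_sup ([set 0%E] `|` [set t^-1%:E | t in G]))%E.
  by move=> Gt; apply: ereal_sup_ubound; right; exists t.
have sup0 : (0 <= ereal_sup ([set 0%E] `|` [set t^-1%:E | t in G]))%E.
  by apply: ereal_sup_ubound; left.
move: inf0 infG ltG; case: (ereal_inf _) => [r| |] //= r0 infG ltG; last first.
  apply/eqP; rewrite eq_le sup0 andbT; apply: ge_ereal_sup => _ [->//|[t Gt <-]].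
  by have := infG t Gt; rewrite leye_eq.
rewrite lee_fin in r0.
(* This forces an infinite supremum when [r = 0], and gives [r^-1 <= m] when [r > 0]. *)
have key m : ereal_sup ([set 0%E] `|` [set t^-1%:E | t in G]) = m%:E ->
    0 < m /\ m^-1 <= r.
  move=> supE; rewrite supE in supG sup0.
  have m0 : 0 < m.
    have [|t Gt _] := ltG (r + 1); first by rewrite lte_fin ltrDl.
    by have := supG t Gt; rewrite lee_fin; apply: lt_le_trans; rewrite invr_gt0 G0.
  split=> //; rewrite leNgt; apply/negP => rm.
  have [t Gt tm] := ltG _ rm; have := supG t Gt.
  rewrite lee_fin leNgt => /negP; apply.
  by rewrite -[m]invrK ltf_pV2 ?posrE ?invr_gt0 // G0.
case: eqVneq => [rE|rN0].
  move: sup0 key; case: (ereal_sup _) => [m| |] // _ /(_ m erefl)[m0].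
  by rewrite rE leNgt invr_gt0 m0.
have rp : 0 < r by rewrite lt_neqAle eq_sym rN0.
apply/eqP; rewrite eq_le; apply/andP; split.
  apply: ge_ereal_sup => _ [->|[t Gt <-]]; rewrite lee_fin ?invr_ge0 //.
  have rt := infG t Gt; rewrite lee_fin in rt.
  by rewrite lef_pV2 // posrE G0.
move: sup0 key; case: (ereal_sup _) => [m| |] // _; last by rewrite leey.
move=> /(_ m erefl)[m0 mr]; rewrite lee_fin -[m]invrK lef_pV2 ?posrE //.
by rewrite invr_gt0.
Qed.

Theorem theorem3p1 (R : realType) (X Y : completeNormedModType R)
  (F : X -> set Y) (A : set X) (ybar : Y) (xbar : X) :
  closed_convex_map F ->
  closed A -> convex_set (A : set (convex_lmodType X)) ->
  solset F A ybar xbar ->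
  einv (subreg A F xbar ybar) = eta_A A F xbar ybar /\
  eta_A A F xbar ybar = einv (tau_A A F xbar ybar).
Proof.
move=> cF clA cA Sxbar.
have eta_tau : eta_A A F xbar ybar = einv (tau_A A F xbar ybar).
  rewrite /tau_A -ereal_sup_inv_einv_inf; last by move=> t [].
  congr (ereal_sup (_ `|` _)); apply/seteqP; split=> [_ [t [t0 [d d0 H]] <-]|].
    exists t^-1; last by rewrite invrK.
    split; first by rewrite invr_gt0.
    by exists d => // x Sx xd; apply: condP_condQ => //; exact: H.
  move=> _ [t [t0 [d d0 H]] <-]; exists t^-1 => //.
  split; first by rewrite invr_gt0.
  by exists d => // x Sx xd; apply: condQ_condP => //; exact: H.
split=> //; rewrite eta_tau; congr einv.
(* From (Q) to subregularity the constant grows by an arbitrary [e > 0], which the infimum absorbs;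
   the converse keeps the constant. *)
apply/eqP; rewrite eq_le; apply/andP; split.
  apply: le_ereal_inf_tmp => _ [t [t0 [d d0 Q]] <-].
  apply/lee_addgt0Pr => e e0; apply: ereal_inf_lbound.
  exists (t + e) => //; split; first exact: addr_gt0.
  exists (d / 2); first by rewrite divr_gt0.
  by apply: (@condQ_subreg_bound _ _ _ _ _ _ _ t) => //; rewrite ltrDl.
apply: le_ereal_inf_tmp => _ [t [t0 [d d0 H]] <-]; apply: ereal_inf_lbound.
exists t => //; split=> //; exists d => // x Sx xd.
apply: subreg_bound_condQ => //.
have d'0 : 0 < d - `|x - xbar| by rewrite subr_gt0.
apply/nbhs_ballP; exists (d - `|x - xbar|) => //= z; rewrite -ball_normE /= => xz.
apply: H; have : `|z - xbar| <= `|z - x| + `|x - xbar|.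
  by rewrite -[z - xbar](subrKA x) ler_normD.
by rewrite (distrC z x); lra.
Qed.
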